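(* Let $(X,+,d)$ and $(Y,+,\rho)$ be metric abelian groups such that $X$ is uniquely 2-divisible and unbounded by $d$. Let $\varepsilon\geq 0$ and assume that $f\colon X\to Y$ possesses the following asymptotic stability property: $$\limsup_{\min(\|x\|_d,\|y\|_d)\to\infty}\Big\|2f\Big(\frac{x+y}{2}\Big)-f(x)-f(y)\Big\|_\rho\leq\varepsilon. \quad (A)$$ Then $$\Big\|4f\Big(\frac{x+y}{2}\Big)-2f(x)-2f(y)\Big\|_\rho\leq 4\varepsilon\qquad\text{for all }x,y\in X. \quad (B)$$ Furthermore, provided that (A) holds, the constant $4\varepsilon$ is the smallest possible in (B).
   Context: A metric abelian group is a triple $(X,+,d)$ where $(X,+)$ is an abelian group equipped with a translation invariant metric $d$ (i.e. $d(x+z,y+z)=d(x,y)$ for all $x,y,z\in X$). Write $\|x\|_d:=d(x,0)$, and similarly $\|y\|_\rho:=\rho(y,0)$ on $Y$; this is an even subadditive function, not necessarily positively homogeneous. ''$X$ is unbounded by $d$'' means $\sup_{x\in X}\|x\|_d=\infty$. $X$ is uniquely 2-divisible if for every $x\in X$ there is a unique $z\in X$ with $2z:=z+z=x$; this $z$ is denoted $\frac{x}{2}$. For a real-valued function $F$ on $X\times X$, $\limsup_{\min(\|x\|_d,\|y\|_d)\to\infty}F(x,y)$ denotes $\inf_{r>0}\sup\{F(x,y): x,y\in X,\ \|x\|_d\geq r,\ \|y\|_d\geq r\}$ in the extended reals. *)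

(* Defs.v *)
From mathcomp Require Import all_boot all_order all_algebra.
From mathcomp Require Import all_classical all_reals ereal.

Set Implicit Arguments.
Unset Strict Implicit.
Unset Printing Implicit Defensive.

Import Order.TTheory GRing.Theory Num.Theory.
Local Open Scope classical_set_scope.
Local Open Scope ring_scope.

(* A metric abelian group is a zmodType with a function d satisfying this
   predicate. normedZmodType is too restrictive, since it imposes
   `|x *+ n| = `|x| *+ n; metricType has no common structure with zmodType that
   an HB join with translation invariance could extend. *)
Record invariant_metric (R : realType) (X : zmodType) (d : X -> X -> R) :
    Prop := InvariantMetric {
  metric_eq0 : forall x y, d x y = 0 <-> x = y;
  metric_sym : forall x y, d x y = d y x;
  metric_triangle : forall x y z, d x z <= d x y + d y z;
  metric_transl : forall x y z, d (x + z) (y + z) = d x y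
}.

(* Not positively homogeneous in general. *)
Definition gnorm (R : realType) (X : zmodType) (d : X -> X -> R) (x : X) : R :=
  d x 0.

Definition unbounded_by (R : realType) (X : zmodType) (d : X -> X -> R) : Prop :=
  ereal_sup [set (gnorm d x)%:E | x in [set: X]] = +oo%E.

Definition limsup_min_infty (R : realType) (X : zmodType) (d : X -> X -> R)
    (F : X -> X -> R) : \bar R :=
  ereal_inf [set ereal_sup [set (F x y)%:E |
      x in [set x | r <= gnorm d x] & y in [set y | r <= gnorm d y]]
    | r in [set r : R | 0 < r]].

Definition uniquely_2divisible (X : zmodType) : Prop :=
  forall x : X, exists! z : X, z + z = x.

(* Total version of x / 2, with value 0 where x is not divisible by 2. *)
Definition half (X : zmodType) (x : X) : X := xget 0 [set z : X | z + z = x].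

Lemma halfDhalf (X : zmodType) (x : X) :
  uniquely_2divisible X -> half x + half x = x.
Proof.
move=> /(_ x)[z [zx _]].
by apply: (@xgetPex _ 0 [set z | z + z = x]); exists z.
Qed.

Definition jensen_asymptotic (R : realType) (X Y : zmodType)
    (d : X -> X -> R) (rho : Y -> Y -> R) (f : X -> Y) (eps : R) : Prop :=
  (limsup_min_infty d (fun x y =>
     gnorm rho (f (half (x + y)) *+ 2 - f x - f y)) <= eps%:E)%E.

Definition jensen_bounded (R : realType) (X Y : zmodType)
    (rho : Y -> Y -> R) (f : X -> Y) (c : R) : Prop :=
  forall x y : X,
    gnorm rho (f (half (x + y)) *+ 4 - f x *+ 2 - f y *+ 2) <= c.

(* Main.v *)
Require Import Defs.
From mathcomp Require Import all_boot all_order all_algebra.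
From mathcomp Require Import all_classical all_reals ereal.
From mathcomp Require Import ring lra.

(** Write [D u v = 2 f ((u + v) / 2) - f u - f v].  For every [z],
    [2 D x y = D (x + z) (y - z) + D (x - z) (y + z)
               - D (x + z) (x - z) - D (y + z) (y - z)],
    and all four arguments on the right are far from [0] once [z] is; since [X]
    is unbounded this gives (B).  The constant is attained by the real function
    with value [eps / 2] at [0], [- eps / 2] at [a] and [- a] for some [a != 0],
    and [0] elsewhere: asymptotically only the term [2 f ((u + v) / 2)]
    survives, while [D a (- a) = 2 eps]. *)

Set Implicit Arguments.
Unset Strict Implicit.
Unset Printing Implicit Defensive.

(* [all_boot] has its own [gnorm], which must not shadow the one of [Defs]. *)
Import Defs.
Import Order.TTheory GRing.Theory Num.Theory.
Local Open Scope classical_set_scope.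
Local Open Scope ring_scope.

Section GroupNorm.
Context (R : realType) (X : zmodType) (d : X -> X -> R).
Hypothesis d_metric : invariant_metric d.

Lemma gnorm0 : gnorm d 0 = 0.
Proof. exact/(metric_eq0 d_metric). Qed.

Lemma gnormN x : gnorm d (- x) = gnorm d x.
Proof.
rewrite /gnorm -(metric_transl d_metric (- x) 0 x) addNr add0r.
exact: (metric_sym d_metric).
Qed.

Lemma gnormD x y : gnorm d (x + y) <= gnorm d x + gnorm d y.
Proof.
apply: le_trans (metric_triangle d_metric (x + y) y 0) _.
by rewrite lerD2r /gnorm -{2}(add0r y) (metric_transl d_metric).
Qed.

Lemma gnormDl x z : gnorm d z - gnorm d x <= gnorm d (x + z).
Proof.
by rewrite lerBlDr -{1}(addrK x z) (addrC z) -(gnormN x) gnormD.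
Qed.

Lemma gnorm_ge0 x : 0 <= gnorm d x.
Proof. by have := gnormD x (- x); rewrite subrr gnorm0 gnormN; lra. Qed.

Lemma unbounded_gnorm : unbounded_by d -> forall r : R, exists x, r <= gnorm d x.
Proof.
move=> X_unbounded r; apply: contrapT => small.
suff : (ereal_sup [set (gnorm d x)%:E | x in [set: X]] <= r%:E)%E.
  by rewrite X_unbounded.
apply: ge_ereal_sup => _ [x _ <-]; rewrite lee_fin leNgt.
by apply/negP => /ltW rx; apply: small; exists x.
Qed.

(** The infimum over radii need not be attained, so a radius is available only for bounds [e']
    strictly above [e]. *)
Lemma limsup_min_infty_leP (F : X -> X -> R) (e : R) :
  (limsup_min_infty d F <= e%:E)%E <->
  forall e', e < e' -> exists2 r, 0 < r &
    forall x y, r <= gnorm d x -> r <= gnorm d y -> F x y <= e'.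
Proof.
split=> [Fe e' ee'|H].
  have : (limsup_min_infty d F < e'%:E)%E by rewrite (le_lt_trans Fe) ?lte_fin.
  move=> /ereal_inf_lt[_ [r r0 <-]] supF; exists r => // x y rx ry.
  rewrite -lee_fin; apply: le_trans (ltW supF).
  by apply: ereal_sup_ubound; exists x => //; exists y.
apply/lee_addgt0Pr => s s0.
have [|r r0 rF] := H (e + s); first by rewrite ltrDl.
apply: le_trans; first by apply: ereal_inf_lbound; exists r.
apply: ge_ereal_sup => _ [x rx [y ry <-]].
by rewrite -EFinD lee_fin rF.
Qed.

End GroupNorm.

Lemma half_eq (X : zmodType) (x z : X) :
  uniquely_2divisible X -> z + z = x -> half x = z.
Proof.
move=> X2 zx; have [w [_ w_uniq]] := X2 x.
by rewrite -(w_uniq z zx) -(w_uniq _ (halfDhalf x X2)).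
Qed.

(** Here [m], [u], [v] stand for the values of [f] at [(x + y) / 2], [x], [y], and [p], [q], [s],
    [t] for those at [x + z], [x - z], [y + z], [y - z]; the latter four cancel. *)
Lemma jensen_defect_identity (Y : zmodType) (m u v p q s t : Y) :
  m *+ 4 - u *+ 2 - v *+ 2 =
    (m *+ 2 - p - t) + (m *+ 2 - q - s)
    + (- (u *+ 2 - p - q) + - (v *+ 2 - s - t)).
Proof.
have -> : m *+ 4 = m *+ 2 + m *+ 2 by rewrite -mulrnDr.
(* Only the doubles occur, so they can be arbitrary elements. *)
move: (m *+ 2) (u *+ 2) (v *+ 2) => {}m {}u {}v.
have subACA (a b c e : Y) : (a - b) + (c - e) = (a + c) - (b + e).
  by rewrite opprD addrACA.
have subrA (a b c : Y) : a - b - c = a - (b + c) by rewrite opprD addrA.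
rewrite !subrA -opprD !subACA (addrACA p t) (addrC t s) opprB.
by rewrite (addrA (m + m - _)) subrK.
Qed.

Lemma jensen_asymptotic_bounded (R : realType) (X Y : zmodType)
    (d : X -> X -> R) (rho : Y -> Y -> R) (f : X -> Y) (eps : R) :
  invariant_metric d -> invariant_metric rho ->
  uniquely_2divisible X -> unbounded_by d ->
  jensen_asymptotic d rho f eps -> jensen_bounded rho f (4 * eps).
Proof.
move=> d_metric rho_metric X2 X_unbounded.
move=> /(limsup_min_infty_leP _ _ _) f_asym x y.
apply/ler_addgt0Pr => s s0.
(* Four defects, each at most [eps + s / 4], add up to [4 * eps + s]. *)
have [|r r0 rD] := f_asym (eps + s / 4); first by rewrite ltrDl; lra.
(* Shifting [z] or [- z] by [x] or [y] costs at most the norm of the shift, which leaves at least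
   [r]. *)
have [z zlarge] :=
  unbounded_gnorm X_unbounded (r + gnorm d x + gnorm d y).
have [x0 y0] := (gnorm_ge0 d_metric x, gnorm_ge0 d_metric y).
have xDz : r <= gnorm d (x + z) by have := gnormDl d_metric x z; lra.
have yDz : r <= gnorm d (y + z) by have := gnormDl d_metric y z; lra.
have xBz : r <= gnorm d (x - z).
  by have := gnormDl d_metric x (- z); rewrite (gnormN d_metric); lra.
have yBz : r <= gnorm d (y - z).
  by have := gnormDl d_metric y (- z); rewrite (gnormN d_metric); lra.
have := rD _ _ xDz yBz; have := rD _ _ xBz yDz.
have := rD _ _ xDz xBz; have := rD _ _ yDz yBz.
(* The shifts cancel in each pair, so the four midpoints are [half (x + y)] twice, [x] and [y]. *)
have cancelz u v : u + z + (v - z) = u + v by rewrite addrACA subrr addr0.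
rewrite !cancelz (addrC (x - z)) cancelz (addrC y x).
rewrite (half_eq X2 (erefl (x + x))) (half_eq X2 (erefl (y + y))).
set Dy := (X in gnorm rho X <= _); set m := half (x + y).
move=> hDy; set Dx := (X in gnorm rho X <= _) => hDx.
set D1 := (X in gnorm rho X <= _) => hD1.
set D2 := (X in gnorm rho X <= _) => hD2.
have -> : f m *+ 4 - f x *+ 2 - f y *+ 2 = (D2 + D1) + (- Dx + - Dy).
  exact: jensen_defect_identity.
have := gnormD rho_metric (D2 + D1) (- Dx + - Dy).
have := gnormD rho_metric D2 D1; have := gnormD rho_metric (- Dx) (- Dy).
rewrite !(gnormN rho_metric); lra.
Qed.

Lemma dist_invariant_metric (R : realType) :
  invariant_metric (fun x y : R => `|x - y|).
Proof.
split=> [x y|x y|x y z|x y z].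
- by split=> [/normr0_eq0/subr0_eq //|->]; rewrite subrr normr0.
- exact: distrC.
- exact: ler_distD.
- by congr `|_|; ring.
Qed.

Definition spike (R : realType) (X : zmodType) (eps : R) (a x : X) : R :=
  if x == 0 then eps / 2
  else if (x == a) || (x == - a) then - (eps / 2) else 0.

Lemma spike_asymptotic (R : realType) (X : zmodType) (d : X -> X -> R)
    (eps : R) (a : X) : invariant_metric d -> 0 <= eps ->
  jensen_asymptotic d (fun x y : R => `|x - y|) (spike eps a) eps.
Proof.
move=> d_metric eps0; apply/(limsup_min_infty_leP _ _ _) => e ee.
have ga := gnorm_ge0 d_metric a.
(* This radius excludes [0], [a] and [- a], the only points where [spike] can be nonzero. *)
exists (gnorm d a + 1) => [|x y ax ay]; first by lra.
have far w : gnorm d a + 1 <= gnorm d w -> spike eps a w = 0.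
  rewrite /spike; case: eqP => [->|_]; first by rewrite (gnorm0 d_metric); lra.
  case: orP => // -[] /eqP ->; rewrite ?(gnormN d_metric); lra.
rewrite /gnorm (far x ax) (far y ay) !subr0 /spike.
have := ee; case: ifP => _; [|case: ifP => _]; rewrite mulr2n ?addr0 ?normr0;
  rewrite -?opprD ?normrN ?ger0_norm; lra.
Qed.

Lemma spike_jensen_bounded (R : realType) (X : zmodType) (eps : R) (a : X)
    (c : R) : uniquely_2divisible X -> a != 0 ->
  jensen_bounded (fun x y : R => `|x - y|) (spike eps a) c -> 4 * eps <= c.
Proof.
(* The midpoint of [a] and [- a] is [0], which gives [4 (eps / 2) + 2 (eps / 2) + 2 (eps / 2) = 4
   eps]. *)
move=> X2 a0 /(_ a (- a)); rewrite subrr (half_eq X2 (addr0 0)).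
rewrite /gnorm /spike oppr_eq0 (negPf a0) !eqxx orbT /=.
apply: le_trans; apply: le_trans (ler_norm _).
rewrite subr0; lra.
Qed.

Theorem theorem2 (R : realType) (X : zmodType) (d : X -> X -> R)
  (d_metric : invariant_metric d)
  (X2 : uniquely_2divisible X) (X_unbounded : unbounded_by d)
  (eps : R) (eps_ge0 : 0 <= eps) :
  (forall (Y : zmodType) (rho : Y -> Y -> R) (f : X -> Y),
     invariant_metric rho ->
     jensen_asymptotic d rho f eps -> jensen_bounded rho f (4 * eps))
  /\
  (forall c : R,
     (forall (Y : zmodType) (rho : Y -> Y -> R) (f : X -> Y),
        invariant_metric rho ->
        jensen_asymptotic d rho f eps -> jensen_bounded rho f c) ->
     4 * eps <= c).
Proof.
split=> [Y rho f rho_metric|c c_bound]; first exact: jensen_asymptotic_bounded.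
(* Any positive bound would do: it only has to force [a != 0]. *)
have [a a1] := unbounded_gnorm X_unbounded 1.
have a0 : a != 0.
  by apply: contraTN a1 => /eqP ->; rewrite (gnorm0 d_metric) -ltNge ltr01.
apply: (spike_jensen_bounded X2 a0).
(* As [c] serves every target group, it may be tested on [R] with its usual distance. *)
by apply: c_bound; [exact: dist_invariant_metric|exact: spike_asymptotic].
Qed.
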